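(* For all integers $d\ge 2$ and $n\ge 1$ there exists a normal perfect $n$-multimagic $d$-dimensional hypercube.
   Context: A $d$-dimensional hypercube of order $m$ ($m$ a positive integer) is an array $M=(M_{i_1,\dots,i_d})$ of natural numbers indexed by $(i_1,\dots,i_d)\in\{1,\dots,m\}^d$. It is normal if its entries are the integers $1,2,\dots,m^d$, each occurring exactly once. It is called perfect magic if there is a single number (the magic sum) equal to the sum of the entries along every axis-parallel line and along every diagonal of every axis-parallel slice of dimension between $2$ and $d$. Explicitly: for every $\delta\in\{-1,0,1\}^d$ with $\delta\neq 0$ and every choice of fixed values $f_j\in\{1,\dots,m\}$ for the indices $j$ with $\delta_j=0$, the sum $\sum_{k=1}^m M_{i_1(k),\dots,i_d(k)}$ equals the magic sum, where $i_j(k)=k$ if $\delta_j=1$, $i_j(k)=m+1-k$ if $\delta_j=-1$, and $i_j(k)=f_j$ if $\delta_j=0$. (For $d=2$ this is a magic square: rows, columns and both main diagonals; for $d=3$ it is a cube in which rows, columns, pillars, the four space diagonals, and the diagonals of each orthogonal slice all have the magic sum.) $M$ is perfect $n$-multimagic if for each $1\le e\le n$ the hypercube obtained by raising every entry of $M$ to the $e$-th power is perfect magic. *)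

(* Defs.v *)
From mathcomp Require Import all_boot all_order all_algebra.

Set Implicit Arguments.
Unset Strict Implicit.
Unset Printing Implicit Defensive.

(* Indices run over {0, ..., m - 1} instead of {1, ..., m}; the reflection
   k |-> m + 1 - k of {1, ..., m} thus becomes k |-> m - 1 - k, i.e. rev_ord. *)
Definition hypercube (d m : nat) : Type := {ffun {ffun 'I_d -> 'I_m} -> nat}.

Definition normal_hypercube (d m : nat) (M : hypercube d m) : Prop :=
  perm_eq (codom M) (iota 1 (m ^ d)).

Definition is_direction (d : nat) (delta : 'I_d -> int) : Prop :=
  (forall j, delta j \in [:: (-1)%R; 0%R; 1%R]) /\ (exists j, delta j <> 0%R).

(* Only the values f j at the coordinates j with delta j = 0 are used. *)
Definition line_point (d m : nat) (delta : 'I_d -> int) (f : 'I_d -> 'I_m)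
    (k : 'I_m) : {ffun 'I_d -> 'I_m} :=
  [ffun j => if delta j == 1%R then k
             else if delta j == (-1)%R then rev_ord k
             else f j].

Definition perfect_magic (d m : nat) (M : hypercube d m) : Prop :=
  exists s : nat, forall (delta : 'I_d -> int) (f : 'I_d -> 'I_m),
    is_direction delta -> \sum_(k < m) M (line_point delta f k) = s.

Definition hypercube_pow (d m : nat) (M : hypercube d m) (e : nat) :
    hypercube d m :=
  [ffun i => M i ^ e].

Definition perfect_multimagic (d m n : nat) (M : hypercube d m) : Prop :=
  forall e : nat, 1 <= e <= n -> perfect_magic (hypercube_pow M e).

(* Main.v *)
Require Import Defs.
From mathcomp Require Import all_boot all_order all_algebra.

(* Take order [p ^ n] for a large prime [p] and read each index in base [p] as a
   vector over [F_p], the index vector of a cell as a polynomial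
   [P = sum_j Q_j X^(n j)] with [deg Q_j < n], and let the base-[p] digits of the
   entry be the values of [P] at [n d] distinct nodes; interpolation gives
   normality. Along a line of direction [delta], [P] is a constant plus
   [Q * sum_j delta_j X^(n j)] with [Q] running over all polynomials of degree
   below [n] (reflection acts as [Q |-> - Q] up to a constant). If the second
   factor vanishes at no node, then any [n] digits of the entry are jointly
   equidistributed along the line, which determines all power sums of exponent
   at most [n]. The nodes [2, 3, 4, ...] qualify, since a sum of signed powers of
   an integer [w > 1] is nonzero, also modulo [p] for [p] large. *)

Set Implicit Arguments.
Unset Strict Implicit.
Unset Printing Implicit Defensive.

Import Order.TTheory GRing.Theory Num.Theory.

(** * Base-[q] expansions *)

Definition radix_value (q n : nat) (c : 'I_n -> 'I_q) : nat :=
  \sum_(i < n) q ^ i * c i.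

(** Digits [a] and [q - 1 - a] add up to [q - 1], and [q ^ n - 1] has all digits [q - 1]. Hence
    reflecting an index reflects each of its digits. *)
Lemma radix_value_rev (q n : nat) (c : 'I_n -> 'I_q) :
  radix_value c + radix_value (fun i => rev_ord (c i)) = (q ^ n).-1.
Proof.
rewrite predn_exp big_distrr -big_split /=; apply: eq_bigr => i _.
rewrite -mulnDr mulnC; congr (_ * _).
case: (c i) => a /= lt_aq; rewrite -addn1 subnDA addnBA ?subn_gt0 //.
by rewrite subnKC ?subn1 // ltnW.
Qed.

Lemma radix_value_lt (q n : nat) (c : 'I_n -> 'I_q) :
  0 < q -> radix_value c < q ^ n.
Proof.
move=> q_gt0; rewrite -[ltnRHS]prednK ?expn_gt0 ?q_gt0 // ltnS.
by rewrite -(radix_value_rev c) leq_addr.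
Qed.

Lemma radix_value_inj (q n : nat) (c c' : 'I_n -> 'I_q) :
  radix_value c = radix_value c' -> c =1 c'.
Proof.
rewrite /radix_value.
elim: n c c' => [|n IHn] c c' eq_cc' i; first by case: i.
have q_gt0 : 0 < q by apply: leq_trans (ltn_ord (c i)).
have radixS (b : 'I_n.+1 -> 'I_q) : \sum_(i < n.+1) q ^ i * b i =
    (\sum_(i < n) q ^ i * b (lift ord0 i)) * q + b ord0.
  rewrite big_ord_recl expn0 mul1n addnC big_distrl /=; congr (_ + _).
  by apply: eq_bigr => k _; rewrite expnSr mulnAC.
move: eq_cc'; rewrite !radixS => eq_cc'.
have eq0 : c ord0 = c' ord0.
  apply: val_inj; move/(congr1 (modn^~ q)): eq_cc'.
  by rewrite /= !modnMDl !modn_small.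
move: eq_cc'; rewrite eq0 => /addIn/eqP; rewrite eqn_pmul2r // => /eqP /IHn eqS.
by case: (unliftP ord0 i) => [k ->|->].
Qed.

(** * Power sums of jointly equidistributed digits *)

Lemma extend_injection (e n N : nat) (h : 'I_e -> 'I_N) : e <= n <= N ->
  exists (s : 'I_n -> 'I_N) (t : 'I_e -> 'I_n),
    injective s /\ forall q, h q = s (t q).
Proof.
case/andP=> le_en; case: N h => [|N] h le_nN.
  exists (widen_ord le_nN), (widen_ord le_en).
  by split=> [i|q]; [case: (widen_ord le_nN i) | case: (h q)].
(* The values of [h], which may repeat, number at most [e <= n]. Listed first in the enumeration [v]
   of all indices, they lie among its first [n] entries, which form [s]. *)
pose u := undup (codom h).
pose v := u ++ [seq i <- enum 'I_N.+1 | i \notin u].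
have uniq_v : uniq v.
  rewrite cat_uniq undup_uniq filter_uniq ?enum_uniq // andbT.
  by apply/hasPn => i; rewrite mem_filter => /andP[].
have size_u : size u <= n.
  by apply: leq_trans (size_undup _) _; rewrite size_codom card_ord.
have mem_v i : i \in v.
  by rewrite mem_cat mem_filter mem_enum andbT orbN.
have size_v : size v = N.+1.
  by rewrite -(card_uniqP uniq_v) (eq_card (B := 'I_N.+1)) ?card_ord.
have lt_ind q : index (h q) v < n.
  apply: leq_trans size_u; rewrite index_cat mem_undup codom_f.
  by rewrite index_mem mem_undup codom_f.
exists (fun i => nth ord0 v i), (fun q => Ordinal (lt_ind q)); split=> [i j|q].
  move/eqP; rewrite nth_uniq ?size_v ?(leq_trans (ltn_ord _)) //.
  by move/eqP/val_inj.
by rewrite nth_index.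
Qed.

(* Expanding the power, every monomial involves at most [e <= n] of the digits
   [y k r]; as any [n] of them take all values in [F ^ n] exactly once when [k]
   varies, its sum over [k] does not depend on [y]. *)
Lemma sum_pow_digits (F T : finType) (n N e : nat)
    (y y' : T -> 'I_N -> F) (a : 'I_N -> F -> nat) :
    #|T| = #|F| ^ n -> e <= n <= N ->
    (forall s : 'I_n -> 'I_N, injective s ->
       injective (fun k => [ffun i => y k (s i)])) ->
    (forall s : 'I_n -> 'I_N, injective s ->
       injective (fun k => [ffun i => y' k (s i)])) ->
  \sum_k (\sum_r a r (y k r)) ^ e = \sum_k (\sum_r a r (y' k r)) ^ e.
Proof.
move=> cardT le_enN inj_y inj_y'.
have expand (b : 'I_N -> nat) :
    (\sum_r b r) ^ e = \sum_(h : {ffun 'I_e -> 'I_N}) \prod_q b (h q).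
  by rewrite -(bigA_distr_bigA (fun _ => b)) prod_nat_const card_ord.
under eq_bigr do rewrite expand; under [RHS]eq_bigr do rewrite expand.
rewrite exchange_big [RHS]exchange_big /=; apply: eq_bigr => h _.
have [s [t [inj_s ht]]] := extend_injection h le_enN.
have sum_values (x : T -> 'I_N -> F) :
    injective (fun k => [ffun i => x k (s i)]) ->
  \sum_k \prod_q a (h q) (x k (h q)) =
  \sum_(v : {ffun 'I_n -> F}) \prod_q a (h q) (v (t q)).
  move=> inj_x; have bij_x := inj_card_bij inj_x.
  rewrite (reindex _ (onW_bij _ (bij_x _))) ?card_ffun ?card_ord ?cardT //=.
  by apply: eq_bigr => k _; apply: eq_bigr => q _; rewrite ffunE ht.
by rewrite !sum_values //; [apply: inj_y' | apply: inj_y].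
Qed.

(** * Signed sums of powers, and digits as field elements *)

Section FieldLemmas.

Local Open Scope ring_scope.

(** If the sum vanishes, [w] divides [delta ord0], which has absolute value at most 1 and so is
    zero. Dividing by [w] and inducting makes every component zero. *)
Lemma sum_signed_powers_neq0 (d w : nat) (delta : 'I_d -> int) :
  (1 < w)%N -> is_direction delta -> \sum_(j < d) delta j * w%:Z ^+ j != 0.
Proof.
move=> w_gt1 [delta_small [j0 delta_j0]]; apply/eqP => sum0.
apply: delta_j0; move: j0.
elim: d delta delta_small sum0 => [|d IHd] delta delta_small.
  by move=> _ [].
rewrite big_ord_recl expr0 mulr1.
under eq_bigr do rewrite exprS mulrCA.
rewrite -mulr_sumr => sum0.
have delta0 : delta ord0 = 0.
  have: (w %| `|delta ord0|)%N.
    move/eqP: sum0; rewrite addr_eq0 => /eqP ->.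
    by rewrite abszN abszM dvdn_mulr.
  have := delta_small ord0; rewrite !inE.
  by case/or3P=> /eqP -> //; rewrite dvdn1 gtn_eqF.
move: sum0; rewrite delta0 add0r => /eqP; rewrite mulf_eq0.
have -> /= : (w%:Z == 0) = false by rewrite eqz_nat gtn_eqF // ltnW.
move/eqP/IHd => IH j; case: (unliftP ord0 j) => [k ->|-> //].
by apply: IH => i; apply: delta_small.
Qed.

(** The bound is uniform in [delta], so one prime above it serves all directions. *)
Lemma abs_sum_signed_powers (d w : nat) (delta : 'I_d -> int) :
    is_direction delta ->
  (`|(\sum_(j < d) delta j * w%:Z ^+ j)%R| <= \sum_(j < d) w ^ j)%N.
Proof.
case=> delta_small _; rewrite -lez_nat abszE (le_trans (ler_norm_sum _ _ _)) //.
rewrite -[leRHS]natz natr_sum; apply: ler_sum => j _.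
rewrite normrM normrX -natz normr_nat natrX.
have := delta_small j; rewrite !inE => /or3P[] /eqP ->;
  by rewrite ?normrN ?normr0 ?normr1 ?mul0r ?mul1r
     ?exprn_ge0 ?ler0n.
Qed.

Lemma Fp_intr_neq0 (p : nat) (x : int) :
  prime p -> x != 0 -> (`|x| < p)%N -> x%:~R != 0 :> 'F_p.
Proof.
move=> p_prime x_neq0 lt_xp; rewrite -normr_gt0 -abszE ltz_nat in x_neq0.
have: (`|x|)%:R != 0 :> 'F_p.
  by rewrite -(dvdn_pcharf (pchar_Fp p_prime)) gtnNdvd.
by case: x {x_neq0 lt_xp} => k //=; rewrite NegzE mulrNz oppr_eq0.
Qed.

Lemma radix_digits (q n : nat) : (0 < q)%N ->
  exists dec : 'I_(q ^ n) -> 'rV['I_q]_n, injective dec /\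
    forall k i, dec (rev_ord k) 0 i = rev_ord (dec k 0 i).
Proof.
move=> q_gt0.
pose enc (v : 'rV['I_q]_n) := Ordinal (radix_value_lt (v 0) q_gt0).
have inj_enc : injective enc.
  by move=> v v' [/radix_value_inj eq_vv']; apply/rowP.
have [|dec encK decK] := inj_card_bij inj_enc.
  by rewrite card_mx !card_ord mul1n.
exists dec; split=> [|k i]; first exact: can_inj decK.
suff -> : dec (rev_ord k) = \row_i rev_ord (dec k 0 i) by rewrite mxE.
apply: inj_enc; rewrite decK; apply: val_inj => /=.
rewrite -[in LHS](decK k) /= subnS predn_sub -(radix_value_rev (dec k 0)) addKn.
by apply: eq_bigr => l _; rewrite mxE.
Qed.

(** [rev_ord c] is the modulus minus [c + 1], and the modulus is zero in the field. *)
Lemma Fp_rev_ord (p : nat) (c : 'F_p) : rev_ord c = - 1 - c.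
Proof.
apply/eqP; rewrite eq_sym subr_eq -[rev_ord c]natr_Zp -[c in _ + c]natr_Zp.
rewrite -natrD eq_sym -subr_eq0 opprK natr1 /= -addnS subnK // Zp_nat.
by apply/eqP/val_inj; rewrite /= modnn.
Qed.

(** * Interpolation and polynomials along a line *)

Lemma poly_eq_of_values (F : fieldType) (N : nat) (z : 'I_N -> F)
    (P P' : {poly F}) :
    injective z -> (size P <= N)%N -> (size P' <= N)%N ->
  (forall r, P.[z r] = P'.[z r]) -> P = P'.
Proof.
move=> inj_z szP szP' eq_val; apply/eqP; rewrite -subr_eq0; apply/eqP.
apply: (@roots_geq_poly_eq0 _ _ (codom z)).
- by apply/allP => _ /codomP[r ->]; rewrite rootE hornerD hornerN eq_val subrr.
- by rewrite map_inj_uniq ?enum_uniq.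
- rewrite size_codom card_ord (leq_trans (size_polyD _ _)) //.
  by rewrite size_polyN geq_max szP.
Qed.

(** The vectors are laid end to end as coefficients, [u j] filling the degrees from [n * j] to
    [n * j + n - 1]. *)
Definition block_poly (F : fieldType) (d n : nat) (u : 'I_d -> 'rV[F]_n) :
    {poly F} :=
  \sum_(j < d) rVpoly (u j) * 'X^(n * j).

Lemma size_block_poly (F : fieldType) (d n : nat) (u : 'I_d -> 'rV[F]_n) :
  (size (block_poly u) <= n * d)%N.
Proof.
apply: leq_trans (size_sum _ _ _) _; apply/bigmax_leqP => j _.
apply: leq_trans (size_polyMleq _ _) _; rewrite size_polyXn addnS /=.
apply: (@leq_trans (n + n * j)); first by rewrite leq_add2r size_poly.
by rewrite -mulnS leq_mul2l ltn_ord orbT.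
Qed.

Lemma block_poly_inj (F : fieldType) (d n : nat) (u u' : 'I_d -> 'rV[F]_n) :
  block_poly u = block_poly u' -> u =1 u'.
Proof.
have coef_block (v : 'I_d -> 'rV[F]_n) (j : 'I_d) (i : 'I_n) :
    (block_poly v)`_(n * j + i) = v j 0 i.
  rewrite coef_sum (bigD1 j) //= big1 => [|k neq_kj].
    by rewrite addr0 coefMXn ltnNge leq_addr /= addKn coef_rVpoly_ord.
  (* Block [k] could contribute only if [n * j + i] had quotient [k] by [n], but that quotient is
     [j]. *)
  rewrite coefMXn; case: ltnP => // le_kj.
  rewrite coef_poly; case: ltnP => // lt_n.
  case/eqP: neq_kj; apply: val_inj => /=.
  have n_gt0 : (0 < n)%N by apply: leq_ltn_trans (ltn_ord i).
  have div_j : ((n * j + i) %/ n)%N = j.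
    by rewrite mulnC divnMDl // divn_small ?addn0.
  rewrite -div_j -(subnK le_kj) addnC [X in (X + _)%N]mulnC divnMDl //.
  by rewrite divn_small ?addn0.
by move=> eq_uu' j; apply/rowP => i; rewrite -!coef_block eq_uu'.
Qed.

(** At a node the values for [k] and [k'] differ by the difference of the polynomials of [dec k] and
    [dec k'] times the nonzero signed sum, as the constants cancel. Agreement at [n] distinct nodes
    forces these polynomials, of degree below [n], to be equal. *)
Lemma line_values_inj (F : fieldType) (d m n N : nat) (z : 'I_N -> F)
    (dec : 'I_m -> 'rV[F]_n) (delta : 'I_d -> int) (f : 'I_d -> 'I_m)
    (s : 'I_n -> 'I_N) :
    injective z -> injective dec ->
    (forall k, dec (rev_ord k) = const_mx (- 1) - dec k) ->
    (forall j, delta j \in [:: - 1; 0; 1]) ->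
    (forall r, \sum_(j < d) (delta j)%:~R * z r ^+ (n * j) != 0) ->
    injective s ->
  injective (fun k =>
    [ffun i => (block_poly (dec \o line_point delta f k)).[z (s i)]]).
Proof.
move=> inj_z inj_dec dec_rev delta_small sum_neq0 inj_s k k' /ffunP eq_kk'.
apply: inj_dec; apply: (can_inj rVpolyK).
apply: (poly_eq_of_values (inj_comp inj_z inj_s)); rewrite ?size_poly //.
move=> i /=.
have := eq_kk' i; rewrite !ffunE; set x := z (s i) => /eqP.
rewrite -subr_eq0 !horner_sum -sumrB.
rewrite (eq_bigr (fun j : 'I_d =>
    ((rVpoly (dec k)).[x] - (rVpoly (dec k')).[x]) *
    ((delta j)%:~R * x ^+ (n * j)))) => [|j _].
  by rewrite -mulr_sumr mulf_eq0 (negPf (sum_neq0 _)) orbF subr_eq0 => /eqP.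
rewrite !hornerM !hornerXn /= !ffunE -mulrBl mulrA; congr (_ * _).
have := delta_small j; rewrite !inE => /or3P[] /eqP -> /=.
- by rewrite !dec_rev !linearB !hornerD !hornerN mulrN1 !opprB
    addrC addrA subrK.
- by rewrite subrr mulr0.
- by rewrite mulr1.
Qed.

(** * Choice of the prime and the nodes *)

Lemma exists_nodes (d n N : nat) : (0 < n)%N ->
  exists (p : nat) (z : 'I_N -> 'F_p), injective z /\
    forall (delta : 'I_d -> int) (r : 'I_N), is_direction delta ->
      \sum_(j < d) (delta j)%:~R * z r ^+ (n * j) != 0.
Proof.
move=> n_gt0.
pose w (r : nat) := (r.+2 ^ n)%N.
(* The term [N] keeps the nodes distinct modulo [p]; the double sum bounds every signed sum at every
   node. *)
have [p lt_p p_prime] := prime_above (N + \sum_(r < N) \sum_(j < d) w r ^ j).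
exists p, (fun r => (r.+2)%:R); split=> [r r' /eqP eq_rr'|delta r delta_dir].
  have lt_rp (t : 'I_N) : (t < p)%N.
    by apply: leq_trans (ltnW lt_p); apply: ltn_addr.
  apply/val_inj/eqP; move: eq_rr'.
  rewrite -[r.+2%:R]natr1 -[r'.+2%:R]natr1 -!natr1 !(inj_eq (addIr _)).
  by move=> /eqP/(congr1 val); rewrite /= !val_Fp_nat // !modn_small // => ->.
have -> : \sum_(j < d) (delta j)%:~R * (r.+2)%:R ^+ (n * j) =
    (\sum_(j < d) delta j * (w r)%:Z ^+ j)%:~R :> 'F_p.
  rewrite rmorph_sum /=; apply: eq_bigr => j _.
  by rewrite rmorphM rmorphXn /= -pmulrn natrX -exprM.
apply: Fp_intr_neq0 => //.
  by apply: sum_signed_powers_neq0 => //; rewrite /w -{1}(exp1n n) ltn_exp2r.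
apply: leq_ltn_trans (abs_sum_signed_powers _ delta_dir) _.
apply: leq_ltn_trans lt_p; rewrite (bigD1 r) //= addnCA.
by rewrite leq_addr.
Qed.

End FieldLemmas.

Theorem theorem4p7 (d n : nat) (hd : 2 <= d) (hn : 1 <= n) :
  exists (m : nat) (M : hypercube d m),
    [/\ 1 < m, normal_hypercube M & perfect_multimagic n M].
Proof.
have [p [z [inj_z sum_neq0]]] := exists_nodes d (n * d) hn.
(* [q] is the order of ['F_p], in the form that makes ['I_q] convertible to ['F_p]. *)
set q := (Zp_trunc (pdiv p)).+2.
have [dec [inj_dec dec_rev]] := @radix_digits q n isT.
have {}dec_rev k : dec (rev_ord k) = (const_mx (- 1) - dec k : 'rV['F_p]_n)%R.
  by apply/rowP => i; rewrite dec_rev Fp_rev_ord !mxE.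
pose y (x : {ffun 'I_d -> 'I_(q ^ n)}) (r : 'I_(n * d)) : 'I_q :=
  ((block_poly (F := 'F_p) (dec \o x)).[z r])%R.
pose M : hypercube d (q ^ n) := [ffun x => (radix_value (y x)).+1].
have m_gt1 : 1 < q ^ n by rewrite -(exp1n n) ltn_exp2r.
have inj_M : injective M.
  move=> x x'; rewrite !ffunE => -[/radix_value_inj eq_y]; apply/ffunP => j.
  apply: inj_dec; move: j; apply: (@block_poly_inj 'F_p).
  by apply: poly_eq_of_values inj_z _ _ eq_y; apply: size_block_poly.
exists (q ^ n), M; split=> //.
  have codom_M : {subset codom M <= iota 1 ((q ^ n) ^ d)}.
    move=> _ /codomP[x ->]; rewrite mem_iota ffunE /= add1n ltnS -expnM.
    exact: radix_value_lt.
  have uniq_M : uniq (codom M) by rewrite map_inj_uniq ?enum_uniq.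
  apply: uniq_perm; rewrite ?iota_uniq //.
  have [] // := uniq_min_size uniq_M codom_M.
  by rewrite size_iota size_codom card_ffun !card_ord.
move=> e /andP[_ le_en].
(* The main diagonal is the reference line: its power sum is taken as the magic sum. *)
pose delta1 (j : 'I_d) : int := 1%R.
have delta1_dir : is_direction delta1.
  by split=> [j|]; rewrite ?inE //; exists (Ordinal (ltnW hd)).
pose k0 : 'I_(q ^ n) := Ordinal (ltnW m_gt1).
exists (\sum_(k < q ^ n) hypercube_pow M e (line_point delta1 (fun=> k0) k)).
(* The shift by 1 in [M] is absorbed into the term of digit 0, so that an entry is a sum of
   functions of single digits. *)
pose a (r : 'I_(n * d)) (u : 'I_q) := q ^ r * u + (r == 0 :> nat).
have M_sum x : M x = \sum_r a r (y x r).
  rewrite ffunE big_split /= -addn1; congr (_ + _).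
  have nd_gt0 : 0 < n * d by rewrite muln_gt0 hn ltnW.
  rewrite (bigD1 (Ordinal nd_gt0)) //= big1 ?addn0 // => r.
  by rewrite -val_eqE => /negPf /= ->.
move=> delta f delta_dir.
under eq_bigr do rewrite ffunE M_sum; under [RHS]eq_bigr do rewrite ffunE M_sum.
apply: (@sum_pow_digits _ _ n);
  rewrite ?card_ord ?le_en ?leq_pmulr ?(ltnW hd) //.
  move=> s; case: (delta_dir) => delta_small _.
  apply: (line_values_inj (F := 'F_p)) => // r; exact: sum_neq0.
move=> s; case: (delta1_dir) => delta_small _.
apply: (line_values_inj (F := 'F_p)) => // r; exact: sum_neq0.
Qed.
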